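(* Let $t\ge1$ and let $n$ be a positive integer divisible by at least $2t$ distinct primes congruent to $3\pmod 4$. Then the deficiency of the maximal real subfield $\mathbb{Q}(\zeta_n)^+$ of the cyclotomic field of $n$th roots of unity is at least $t$. In particular, the deficiency of real cyclotomic fields can be arbitrarily large.
   Context: For a totally real field $F$ of degree $n$ and $0\neq\alpha\in F$, the signature of $\alpha$ is the vector in $\mathbb{F}_2^n$ whose entry at a real embedding $v$ is $0$ if $v(\alpha)>0$ and $1$ if $v(\alpha)<0$. The signatures of the units of $F$ form a subspace of $\mathbb{F}_2^n$ whose dimension is the unit signature rank of $F$; the deficiency $\delta(F)$ is $n$ minus the unit signature rank, which equals the $\mathbb{F}_2$-rank of the group of totally positive units of $F$ modulo squares of units. *)

(* Defs.v *)
From HB Require Import structures.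
From mathcomp Require Import all_boot all_order all_algebra all_field.
From mathcomp Require Import boolp.
Set Implicit Arguments.
Unset Strict Implicit.
Unset Printing Implicit Defensive.
Import Order.TTheory GRing.Theory Num.Theory.
Local Open Scope ring_scope.

(* Membership in the maximal real subfield Q(z)^+ = Q(z) ∩ R of Q(z) ⊂ algC,
   where z will be a primitive n-th root of unity.  Since z is algebraic,
   Q(z) = { p(z) : p ∈ Q[X] }. *)
Definition in_realcyc (z x : algC) : Prop :=
  (exists p : {poly rat}, x = (map_poly ratr p).[z]) /\ x \is Num.real.

(* A real embedding of Q(z)^+ : a ring morphism Q(z)^+ -> R, represented by a
   function algC -> algC whose behaviour is only relevant on Q(z)^+, and whose
   values on Q(z)^+ are real. *)
Definition is_real_embedding (z : algC) (s : algC -> algC) : Prop :=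
  [/\ s 1 = 1,
      (forall x y, in_realcyc z x -> in_realcyc z y -> s (x + y) = s x + s y),
      (forall x y, in_realcyc z x -> in_realcyc z y -> s (x * y) = s x * s y) &
      (forall x, in_realcyc z x -> s x \is Num.real)].

(* e : 'I_d -> ... is a complete, irredundant enumeration of the real
   embeddings of Q(z)^+ (two embeddings are identified when they agree on
   Q(z)^+).  Then d is the degree of Q(z)^+. *)
Definition embedding_enum (z : algC) (d : nat) (e : 'I_d -> algC -> algC) : Prop :=
  [/\ (forall i, is_real_embedding z (e i)),
      (forall i j, i != j -> exists x, in_realcyc z x /\ e i x != e j x) &
      (forall s, is_real_embedding z s ->
         exists i, forall x, in_realcyc z x -> s x = e i x)].

Definition is_unit_realcyc (z u : algC) : Prop :=
  [/\ in_realcyc z u, u != 0, u \in Aint & u^-1 \in Aint].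

Definition signature (d : nat) (e : 'I_d -> algC -> algC) (a : algC) : 'rV['F_2]_d :=
  \row_i (nat_of_bool (e i a < 0)%R)%:R.

Definition unit_signature_space (z : algC) (d : nat) (e : 'I_d -> algC -> algC)
  : 'M['F_2]_d :=
  (\sum_(v : 'rV['F_2]_d |
          `[< exists u, is_unit_realcyc z u /\ signature e u = v >]) <<v>>)%MS.

Definition unit_signature_rank (z : algC) (d : nat) (e : 'I_d -> algC -> algC) : nat :=
  \rank (unit_signature_space z e).

Definition deficiency (z : algC) (d : nat) (e : 'I_d -> algC -> algC) : nat :=
  (d - unit_signature_rank z e)%N.

(* Main.v *)
(* Let p_j, q_j (j < t) be 2t distinct primes congruent to 3 mod 4 dividing n,
   and let F be the field generated by the sqrt(p_j q_j), of degree 2^t inside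
   Q(zeta_n)^+.  The norm to F sends units to units and induces a surjection on
   signature spaces, so the deficiency of Q(zeta_n)^+ is at least that of F.

   A power of every unit of F is a product of units of the quadratic subfields.
   The fundamental units g_j of Q(sqrt(p_j q_j)) are totally positive, and they
   are independent modulo squares of F: (1 + g_j)^2 = N g_j with N = Tr g_j + 2,
   and p_j, q_j = 3 mod 4 forces exactly one of p_j, q_j to divide N to an odd
   power, whereas a rational number that becomes a square in F has the same
   parity of valuation at p_j and q_j.

   Suppose 2^t - t positive units of F had no totally positive nontrivial
   subproduct.  There are 2^t - 1 - t quadratic subfields other than the
   Q(sqrt(p_j q_j)), so some product W of powers of these units, not all
   exponents even, has a power that is a product of powers of the g_j.
   Extracting square roots repeatedly, W itself is such a product, hence totally
   positive: a contradiction. *)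
Require Import Defs.
From HB Require Import structures.
From mathcomp Require Import all_boot all_order all_algebra all_field.
From mathcomp Require Import boolp zify ring.
Set Implicit Arguments.
Unset Strict Implicit.
Unset Printing Implicit Defensive.
Import Order.TTheory GRing.Theory Num.Theory.

(** * Integers *)

Lemma logn_even_square n : 0 < n ->
  (forall p, prime p -> ~~ odd (logn p n)) -> exists x, n = x ^ 2.
Proof.
move=> n_gt0 ev; exists (\prod_(p <- primes n) p ^ (logn p n)./2).
rewrite {1}(prod_prime_decomp n_gt0) prime_decompE big_map /=.
rewrite (big_morph (fun x => x ^ 2) (id1 := 1%N) (op1 := muln)) //; last first.
  by move=> a b; rewrite expnMn.
rewrite !big_seq; apply: eq_bigr => p; rewrite mem_primes => /andP[/ev o _].
by rewrite -expnM muln2 halfK (negbTE o) subn0.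
Qed.

Lemma coprime_mul_square (a b r : nat) :
  coprime a b -> a * b = r ^ 2 -> exists x, a = x ^ 2.
Proof.
have [->|a_gt0] := posnP a; first by exists 0.
have [->|b_gt0] := posnP b.
  by rewrite /coprime gcdn0 => /eqP-> _; exists 1.
move=> cop Dr; apply: logn_even_square => // p pr_p; apply/negP => od.
have := congr1 (logn p) Dr; rewrite lognM // lognX mul2n => /(congr1 odd).
rewrite odd_double oddD od /= => /negbFE; rewrite -[odd _]negbK => od'.
have := coprime_dvdl (pfactor_dvdnn p a) (coprime_dvdr (pfactor_dvdnn p b) cop).
rewrite coprime_pexpl ?coprime_pexpr ?lt0n; last 2 first.
- by apply: contraNneq od' => ->.
- by apply: contraTneq od => ->.
by rewrite /coprime gcdnn => /eqP p1; rewrite p1 in pr_p.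
Qed.

(** Dividing both factors by their gcd [d] leaves coprime numbers whose product is a square, hence
    squares; [d] is 1, 2 or 4, and 4 is absorbed into the squares. *)
Lemma mul_square_gcd4 (a b r : nat) :
  0 < a -> (gcdn a b %| 4) -> a * b = r ^ 2 ->
  exists x y, a = x ^ 2 /\ b = y ^ 2 \/ a = 2 * x ^ 2 /\ b = 2 * y ^ 2.
Proof.
move=> a_gt0 dv4 Dr; set d := gcdn a b in dv4.
have d_gt0 : 0 < d by rewrite gcdn_gt0 a_gt0.
have [Da Db] : a = a %/ d * d /\ b = b %/ d * d.
  by rewrite !divnK ?dvdn_gcdl ?dvdn_gcdr.
have cop : coprime (a %/ d) (b %/ d).
  by rewrite /coprime -(eqn_pmul2r d_gt0) muln_gcdl -Da -Db mul1n.
have Dr' : (a %/ d) * (b %/ d) * d ^ 2 = r ^ 2.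
  by rewrite -Dr [in RHS]Da [in RHS]Db; ring.
have [s Ds] : exists s, r = s * d.
  by apply/dvdnP; rewrite -(dvdn_pexp2r _ _ (isT : 0 < 2)) -Dr' dvdn_mull.
have Dr'' : (a %/ d) * (b %/ d) = s ^ 2.
  by apply/eqP; rewrite -(eqn_pmul2r (_ : 0 < d ^ 2)) ?expn_gt0 ?d_gt0 // Dr' Ds expnMn.
have [x Dx] := coprime_mul_square cop Dr''.
have [y Dy] : exists y, b %/ d = y ^ 2.
  by apply: (@coprime_mul_square _ (a %/ d) s); rewrite 1?coprime_sym // mulnC.
rewrite {}Dx in Da; rewrite {}Dy in Db.
have : d \in divisors 4 by rewrite -dvdn_divisors.
rewrite (_ : divisors 4 = [:: 1; 2; 4]) // !inE => /or3P[] /eqP d4; rewrite d4 in Da Db.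
- by exists x, y; left; rewrite Da Db !muln1.
- exists x, y; right; split; [rewrite Da | rewrite Db]; ring.
- exists (2 * x), (2 * y); left; split; [rewrite Da | rewrite Db]; ring.
Qed.

Lemma square_mod4 x : x ^ 2 %% 4 = 0 \/ x ^ 2 %% 4 = 1.
Proof.
rewrite -modnXm; have : x %% 4 < 4 by rewrite ltn_mod.
by case: (x %% 4) => [|[|[|[|]]]] // _; [left|right|left|right].
Qed.

Lemma mod4_square_add2 a x y : a %% 4 = 1 -> a * x ^ 2 <> y ^ 2 + 2.
Proof.
move=> a1 /(congr1 (modn^~ 4)); rewrite -modnMml a1 mul1n -modnDml.
by case: (square_mod4 x) => ->; case: (square_mod4 y) => ->.
Qed.

Lemma mod4_square_sub2 a x y : a %% 4 = 1 -> x ^ 2 <> a * y ^ 2 + 2.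
Proof.
move=> a1 /(congr1 (modn^~ 4)); rewrite -modnDml -modnMml a1 mul1n.
by case: (square_mod4 x) => ->; case: (square_mod4 y) => ->.
Qed.

(** Otherwise [x ^ 2 = - 2 ^ 2] in ['F_p], and raising both sides to the odd power [(p.-1)./2] gives
    [1 = -1] by Fermat's little theorem. *)
Lemma prime3mod4_ndvd_sqrD4 p x : prime p -> p %% 4 = 3 -> ~~ (p %| x ^ 2 + 4).
Proof.
move=> pr_p p3; apply/negP => dv.
have p_gt2 : 2 < p.
  rewrite ltn_neqAle prime_gt1 // andbT; apply/eqP => e.
  by rewrite -e in p3.
have pcharFp : p \in [pchar 'F_p]%R by exact: pchar_Fp.
have fermat (y : 'F_p) : (y != 0 -> y ^+ p.-1 = 1)%R.
  move=> y0; apply: (mulfI y0); rewrite -exprS prednK ?prime_gt0 // mulr1.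
  by have := expf_card y; rewrite card_Fp.
have two0 : (2%:R != 0 :> 'F_p)%R.
  by rewrite -(dvdn_pcharf pcharFp) gtnNdvd.
have e : ((x%:R : 'F_p) ^+ 2 = - 2%:R ^+ 2)%R.
  apply/eqP; rewrite -addr_eq0 -!natrX -natrD -(dvdn_pcharf pcharFp).
  exact: dv.
have x0 : (x%:R != 0 :> 'F_p)%R.
  apply: contraNneq two0 => x0; rewrite -sqrf_eq0 -oppr_eq0 -e x0.
  by rewrite expr0n.
have Dp : p.-1 = 2 * (p.-1)./2 by lia.
have od : odd (p.-1)./2 by lia.
have := fermat _ x0; rewrite Dp exprM e exprNn -signr_odd od expr1 mulN1r.
rewrite -exprM -Dp (fermat _ two0) => /eqP.
by rewrite eq_sym -subr_eq0 opprK -[(1 + 1)%R]/(2%:R)%R (negbTE two0).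
Qed.

(* [N] stands for T + 2, where T is the trace of a unit of norm 1 of
   Q(sqrt(p q)); then N (N - 4) = T^2 - 4 is p q times a square. *)
Section QuadraticNorms.

Variables p q N r : nat.
Hypotheses (pr_p : prime p) (pr_q : prime q) (neq_pq : p != q).
Hypotheses (p3 : p %% 4 = 3) (q3 : q %% 4 = 3).
Hypotheses (N_gt4 : 4 < N) (DN : N * (N - 4) * (p * q) = r ^ 2).

Lemma gcdn_sub4_dvd4 : gcdn N (N - 4) %| 4.
Proof.
by rewrite -[X in _ %| X](subKn (ltnW N_gt4)) dvdn_sub ?dvdn_gcdl ?dvdn_gcdr.
Qed.

Lemma odd_prime_sub4 l : prime l -> odd l -> l %| N -> ~~ (l %| N - 4).
Proof.
move=> pr_l od_l dv1; apply/negP => dv2.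
have : l %| 2 ^ 2.
  apply: dvdn_trans gcdn_sub4_dvd4; by rewrite dvdn_gcd dv1.
rewrite Euclid_dvdX // andbT dvdn_prime2 // => /eqP e; by rewrite e in od_l.
Qed.

Lemma odd_logn_sum l : prime l ->
  odd (logn l N) (+) odd (logn l (N - 4)) = (l == p) (+) (l == q).
Proof.
move=> pr_l; have := congr1 (fun x => odd (logn l x)) DN.
have N_gt0 : 0 < N by exact: ltn_trans N_gt4.
rewrite lognX mul2n odd_double !lognM ?muln_gt0 ?subn_gt0 ?N_gt0 ?N_gt4 ?prime_gt0 //.
rewrite !oddD (logn_prime l pr_p) (logn_prime l pr_q).
by do 2![case: (odd _)]; case: (l == p); case: (l == q).
Qed.

(** The valuations of [N] and [N - 4] at [l] have equal parity, and an odd prime divides at most one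
    of the two numbers. *)
Lemma even_logn l : prime l -> odd l -> l != p -> l != q -> ~~ odd (logn l N).
Proof.
move=> pr_l od_l /negbTE lp /negbTE lq; have := odd_logn_sum pr_l.
rewrite lp lq; have [dv|ndv] := boolP (l %| N).
  by rewrite (lognE _ (N - 4)) (negbTE (odd_prime_sub4 pr_l od_l dv)) !andbF /= addbF => ->.
by rewrite lognE (negbTE ndv) !andbF.
Qed.

(* Equal parities mean that p q divides N - 4 or N.  Writing the cofactors as
   squares or twice squares leaves, besides N = x^2, only p q y^2 = x^2 + 4,
   excluded as -1 is not a square mod p, and p q y^2 = x^2 +- 2, excluded mod 4. *)
Lemma square_of_eq_parity :
  odd (logn p N) = odd (logn q N) -> exists x, N = x ^ 2.
Proof.
have N_gt0 : 0 < N by exact: ltn_trans N_gt4.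
have odd3 l : l %% 4 = 3 -> odd l by lia.
have [sp sq] := (odd_logn_sum pr_p, odd_logn_sum pr_q).
have ndv_odd l : ~~ (l %| N) -> ~~ odd (logn l N).
  by rewrite lognE => /negbTE->; rewrite !andbF.
have ndv_odd' l : ~~ (l %| N - 4) -> ~~ odd (logn l (N - 4)).
  by rewrite lognE => /negbTE->; rewrite !andbF.
have odp := odd_prime_sub4 pr_p (odd3 _ p3).
rewrite eqxx (negbTE neq_pq) in sp; rewrite eqxx eq_sym (negbTE neq_pq) in sq.
have pq_gt0 : 0 < p * q by rewrite muln_gt0 !prime_gt0.
have cop_pq : coprime p q by rewrite prime_coprime // dvdn_prime2.
have pq1 : (p * q) %% 4 = 1 by rewrite -modnMm p3 q3.
(* [p * q] is squarefree, hence divides [r]; in both cases below [DN] can then be divided by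
   [(p * q) ^ 2]. *)
have pq_sq : r ^ 2 = (p * q * (r %/ (p * q))) ^ 2.
  rewrite mulnC divnK // Gauss_dvd //.
  have dvr l : prime l -> l %| p * q -> l %| r.
    move=> pr_l dvl; have : l %| r ^ 2 by rewrite -DN dvdn_mull.
    by rewrite Euclid_dvdX // andbT.
  by rewrite (dvr p pr_p (dvdn_mulr q (dvdnn p))) (dvr q pr_q (dvdn_mull p (dvdnn q))).
have [dvN|ndvN] := boolP (p %| N) => parity.
  have dvqN : q %| N.
    apply/negPn/negP => /ndv_odd; rewrite -parity.
    by move: sp; rewrite (negbTE (ndv_odd' _ (odp dvN))) addbF => ->.
  have /dvdnP[m Dm] : p * q %| N by rewrite Gauss_dvd ?dvN.
  have Dr : m * (N - 4) = (r %/ (p * q)) ^ 2.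
    apply/eqP; rewrite -(eqn_pmul2r (_ : 0 < (p * q) ^ 2)) ?expn_gt0 ?pq_gt0 //.
    by rewrite -[X in _ == X]expnMn (mulnC (r %/ _)) -pq_sq -DN {2}Dm; apply/eqP; ring.
  have g4 : gcdn m (N - 4) %| 4.
    apply: dvdn_trans gcdn_sub4_dvd4; rewrite dvdn_gcd dvdn_gcdr andbT.
    by rewrite {2}Dm (dvdn_trans (dvdn_gcdl _ _)) ?dvdn_mulr.
  have m_gt0 : 0 < m by move: N_gt0; rewrite {1}Dm muln_gt0 => /andP[].
  have [x [y [[Dx Dy]|[Dx Dy]]]] := mul_square_gcd4 m_gt0 g4 Dr.
    have /negP[] := prime3mod4_ndvd_sqrD4 y pr_p p3.
    by rewrite -Dy subnK // ltnW.
  case: (mod4_square_add2 (x := x) (y := y) pq1).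
  apply/eqP; rewrite -(eqn_pmul2l (isT : 0 < 2)); apply/eqP.
  transitivity N; first by rewrite Dm Dx; clear; ring.
  by rewrite -(subnK (ltnW N_gt4)) Dy; clear; ring.
have dvN4 l : odd (logn l (N - 4)) -> l %| N - 4.
  by move=> h; apply/negPn/negP => /ndv_odd'; rewrite h.
have /dvdnP[m Dm] : p * q %| N - 4.
  rewrite Gauss_dvd // !dvN4 //.
    by move: sq; rewrite -parity (negbTE (ndv_odd _ ndvN)).
  by move: sp; rewrite (negbTE (ndv_odd _ ndvN)).
have Dr : N * m = (r %/ (p * q)) ^ 2.
  apply/eqP; rewrite -(eqn_pmul2r (_ : 0 < (p * q) ^ 2)) ?expn_gt0 ?pq_gt0 //.
  by rewrite -[X in _ == X]expnMn (mulnC (r %/ _)) -pq_sq -DN Dm; apply/eqP; ring.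
have g4 : gcdn N m %| 4.
  apply: dvdn_trans gcdn_sub4_dvd4; rewrite dvdn_gcd dvdn_gcdl.
  by rewrite Dm (dvdn_trans (dvdn_gcdr _ _)) ?dvdn_mulr.
have [x [y [[Dx Dy]|[Dx Dy]]]] := mul_square_gcd4 N_gt0 g4 Dr; first by exists x.
case: (mod4_square_sub2 (x := x) (y := y) pq1).
apply/eqP; rewrite -(eqn_pmul2l (isT : 0 < 2)) -Dx -(subnK (ltnW N_gt4)) Dm Dy.
by apply/eqP; clear; ring.
Qed.

End QuadraticNorms.

(** * Algebraic numbers *)

Local Open Scope ring_scope.

Local Notation aut := {rmorphism algC -> algC}.

(** The roots of the minimal polynomial of [x] generate a Galois extension of the rationals. Its
    automorphisms extend to [algC], so [x] lies in its fixed field, which is the base field. *)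
Lemma fixed_Crat x : (forall nu : aut, nu x = x) -> x \in Crat.
Proof.
move=> fix_x; have [r Dr] := closed_field_poly_normal (minCpoly x).
rewrite (monicP (minCpoly_monic x)) scale1r in Dr.
have [Qs [QsC [s1 Ds1 gen]]] := num_field_exists r.
have [q [Dq mq] _] := minCpolyP x.
have QsCalg a : QsC (a%:A) = ratr a by rewrite alg_num_field fmorph_rat.
have splitQs : SplittingField.axiom Qs.
  exists (map_poly (in_alg Qs) q); first exact: alg_polyOver.
  exists s1 => //; rewrite -(eqp_map QsC) -map_poly_comp.
  rewrite (eq_map_poly QsCalg) -Dq Dr -Ds1 rmorph_prod big_map.
  rewrite [X in _ %= X](eq_bigr (fun z => 'X - (QsC z)%:P)) ?eqpxx // => i _.
  by rewrite rmorphB /= map_polyX map_polyC.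
pose Lm := FieldExt_isSplittingField.Build rat Qs splitQs.
pose L : splittingFieldType rat := HB.pack Qs Lm.
have rx : x \in r by rewrite -root_prod_XsubC -Dr root_minCpoly.
have /mapP[y _ Dy] : x \in map QsC s1 by rewrite Ds1.
have galL : galois 1 {:L}.
  apply/and3P; split; [exact: sub1v | | exact: normalFieldf].
  apply/separableP => u _; apply: pcharf0_separable => p.
  by rewrite pchar_lalg pchar_num.
have : (y : L) \in fixedField 'Gal({:L} / 1%AS)%g.
  apply/fixedFieldP; first exact: memvf.
  move=> g _; have [nu Dnu] := extend_algC_subfield_aut QsC (gal_repr g).
  by apply: (fmorph_inj QsC); rewrite Dnu -Dy fix_x.
rewrite (galois_fixedField galL) => /vlineP[a Dya].
by apply/CratP; exists a; rewrite Dy (Dya : y = a%:A) QsCalg.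
Qed.

Lemma expz_eq1_pos (g : algC) (k : int) : 0 < g -> g ^ k = 1 -> k != 0 -> g = 1.
Proof.
have pos (n : nat) : 0 < g -> g ^+ n.+1 = 1 -> g = 1.
  by move=> g_gt0 /eqP; rewrite pexpr_eq1 ?ltW // => /eqP.
case: k => [[|n]|n] g_gt0 // gk _; first exact: pos gk.
apply: (pos n) => //; apply: invr_inj; rewrite invr1 -[RHS]gk.
by [].
Qed.

Lemma ltr_add_inv (u v : algC) : 1 <= u -> u < v -> u + u^-1 < v + v^-1.
Proof.
move=> u1 uv; have u_gt0 : 0 < u by apply: lt_le_trans u1.
have v_gt0 : 0 < v by apply: lt_trans uv.
rewrite -subr_gt0 (_ : _ - _ = (v - u) * (1 - (u * v)^-1)); last first.
  by field; rewrite !gt_eqF.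
rewrite mulr_gt0 ?subr_gt0 // invf_lt1 ?mulr_gt0 //.
by rewrite -[1]mulr1 (le_lt_trans (_ : _ <= u * 1)) ?ler_pM2r ?ltr_pM2l // (le_lt_trans u1).
Qed.

Lemma Crat_Aint_nat (x : algC) :
  x \in Crat -> x \in Aint -> 0 <= x -> exists n : nat, x = n%:R.
Proof.
move=> xQ xA x_ge0; apply/natrP; rewrite natrEint x_ge0 andbT.
exact: Cint_rat_Aint.
Qed.

Lemma sqr_natr_Aint (x : algC) (m : nat) : x ^+ 2 = m%:R -> x \in Aint.
Proof.
move=> Dx; apply: (@root_monic_Aint ('X^2 - m%:R%:P)).
- by rewrite /root !hornerE Dx subrr.
- by rewrite monicE lead_coefXnsubC.
- by rewrite polyOverXnsubC rpred_nat.
Qed.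

Lemma Crat_sqr_natr (x : algC) (m : nat) :
  x \in Crat -> x ^+ 2 = m%:R -> exists r : nat, (m = r ^ 2)%N.
Proof.
move=> xQ Dx; have /intrP[k Dk] := Cint_rat_Aint xQ (sqr_natr_Aint Dx).
exists `|k|%N; apply/eqP; rewrite -(eqr_nat algC) -Dx Dk natrX natr_absz.
by rewrite -rmorphXn /= -[X in _ == X]rmorphXn /= real_normK ?num_real.
Qed.

Lemma odd_logn_prod (I : finType) (P : pred I) (F : I -> nat) l :
  (forall i, P i -> 0 < F i)%N ->
  odd (logn l (\prod_(i | P i) F i)) = \big[addb/false]_(i | P i) odd (logn l (F i)).
Proof.
move=> F0; suff [] : (0 < \prod_(i | P i) F i)%N /\
  odd (logn l (\prod_(i | P i) F i)) = \big[addb/false]_(i | P i) odd (logn l (F i)) by [].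
apply: (big_rec2 (fun x y => (0 < x)%N /\ odd (logn l x) = y)) => [|i b n Pi [n0 <-]].
  by rewrite logn1.
by rewrite muln_gt0 F0 // n0 lognM ?F0 // oddD.
Qed.

(** * Integer relations with an odd coefficient *)

Lemma int_halve (k : int) : exists h : int, k = (odd `|k|)%:Z + h * 2.
Proof. by exists (k %/ 2)%Z; lia. Qed.

(** Descent on the size of [c i0]: as long as all entries are even the family is halved, and [d]
    collects the power of 2 removed. *)
Lemma int_halve_family (I : finType) (c : I -> int) i0 : c i0 != 0 ->
  exists (c' : I -> int) (d : int),
    [/\ d != 0, forall i, c i = c' i * d & exists i, odd `|c' i|].
Proof.
have [n] := ubnP `|c i0|%N; elim: n c => // n IH c le_c c0.
have [/existsP[i od]|/existsPn ev] := boolP [exists i, odd `|c i|].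
  by exists c, 1; split=> // [i'|]; [rewrite mulr1 | exists i].
have [h Dh] := boolp.choice (fun i => int_halve (c i)).
have {}Dh i : c i = h i * 2 by rewrite {1}Dh (negbTE (ev i)) add0r.
have h0 : h i0 != 0 by apply: contraNneq c0 => h0; rewrite Dh h0.
have [|c' [d [d0 Dc od]]] := IH h _ h0; first by move: le_c; rewrite Dh; lia.
exists c', (d * 2); split=> // [|i]; first by rewrite mulf_neq0.
by rewrite Dh Dc mulrA.
Qed.

(** More rows than columns give a nonzero rational vector in the left kernel; denominators are
    cleared, then the common power of 2 is divided out. *)
Lemma odd_int_relation (m s : nat) (a : 'M[int]_(s, m)) : (m < s)%N ->
  exists c : 'I_s -> int, (exists i, odd `|c i|) /\
    forall k, \sum_i c i * a i k = 0.
Proof.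
move=> lt_ms; pose A := map_mx (intr : int -> rat) a.
have ker_neq0 : kermx A != 0.
  rewrite -mxrank_eq0 mxrank_ker -lt0n subn_gt0.
  exact: leq_ltn_trans (rank_leq_col A) lt_ms.
have [v /sub_kermxP vA /rV0Pn[i0 v0]] := rowV0Pn ker_neq0.
pose c i := numq (v 0 i) * \prod_(j | j != i) denq (v 0 j).
pose D := \prod_j denq (v 0 j).
have Dc i : (c i)%:~R = v 0 i * D%:~R :> rat.
  by rewrite /D (bigD1 i) //= intrM intrM mulrA; congr (_ * _); exact: numqE.
have D0 : D != 0 by apply/prodf_neq0 => j _; apply: denq_neq0.
have c0 : c i0 != 0.
  by rewrite -(intr_eq0 rat) Dc mulf_neq0 // intr_eq0.
have [c' [d [d0 Dc' od]]] := int_halve_family c0; exists c'; split=> // k.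
apply: (mulIf d0); apply: (intr_inj (R := rat)); rewrite mul0r mulr_suml rmorph_sum /=.
transitivity ((v *m A) 0 k * D%:~R); last by rewrite vA mxE mul0r.
rewrite mxE mulr_suml; apply: eq_bigr => i _.
by rewrite mulrAC -Dc' intrM Dc mxE mulrAC.
Qed.

(** * Units of multiquadratic fields *)

Section Multiquadratic.

Variables (t : nat) (p q : 'I_t -> nat) (sD : 'I_t -> algC).
Hypotheses (pr_p : forall j, prime (p j)) (pr_q : forall j, prime (q j)).
Hypothesis sD_sq : forall j, sD j ^+ 2 = (p j * q j)%:R.
Hypothesis sD_flip : forall A : {set 'I_t}, exists nu : aut,
  forall j, nu (sD j) = (-1) ^+ (j \in A) * sD j.

(* The Galois group of F is identified with [{set 'I_t}] under symmetric
   difference; it is accessed through the automorphisms of all of [algC]. *)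
Definition flip (nu : algC -> algC) : {set 'I_t} := [set j | nu (sD j) != sD j].

Definition symdiff (A B : {set 'I_t}) := [set j | (j \in A) (+) (j \in B)].

Lemma in_symdiff A B j : (j \in symdiff A B) = (j \in A) (+) (j \in B).
Proof. by rewrite inE. Qed.

Lemma symdiffC A B : symdiff A B = symdiff B A.
Proof. by apply/setP=> j; rewrite !inE addbC. Qed.

Lemma symdiffK B : cancel (symdiff^~ B) (symdiff^~ B).
Proof. by move=> A; apply/setP=> j; rewrite !inE addbK. Qed.

Lemma symdiff0 A : symdiff A set0 = A.
Proof. by apply/setP=> j; rewrite !inE addbF. Qed.

Lemma symdiffAA A : symdiff A A = set0.
Proof. by apply/setP=> j; rewrite !inE addbb. Qed.

Lemma sD_neq0 j : sD j != 0.
Proof. by rewrite -sqrf_eq0 sD_sq pnatr_eq0 -lt0n muln_gt0 !prime_gt0. Qed.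

Lemma sD_real j : sD j \is Num.real.
Proof. by rewrite realEsqr sD_sq ler0n. Qed.

Lemma flipP (nu : aut) j : nu (sD j) = (-1) ^+ (j \in flip nu) * sD j.
Proof.
rewrite inE; case: eqVneq => [->|ne] /=; first by rewrite mul1r.
have /eqP := congr1 nu (sD_sq j); rewrite rmorphXn /= rmorph_nat -sD_sq eqf_sqr.
by rewrite (negbTE ne) /= mulN1r => /eqP.
Qed.

Lemma flip_eq (nu : aut) (A : {set 'I_t}) :
  (forall j, nu (sD j) = (-1) ^+ (j \in A) * sD j) -> flip nu = A.
Proof.
move=> nuA; apply/setP=> j; rewrite inE nuA; case: (j \in A).
  by rewrite mulN1r eq_sym -addr_eq0 -mulr2n mulrn_eq0 (negbTE (sD_neq0 j)).
by rewrite mul1r eqxx.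
Qed.

Lemma flip_comp (nu mu : aut) : flip (nu \o mu) = symdiff (flip nu) (flip mu).
Proof.
apply: flip_eq => j /=; rewrite flipP rmorphM rmorphXn rmorphN1 flipP.
by rewrite in_symdiff addbC signr_addb mulrA.
Qed.

Definition rep A : aut := sval (cid (sD_flip A)).

Lemma flip_rep A : flip (rep A) = A.
Proof. exact: flip_eq (svalP (cid (sD_flip A))). Qed.

Lemma flip_conj (nu : aut) : flip (Num.conj \o nu) = flip nu.
Proof.
apply/setP=> j; have r : nu (sD j) \is Num.real by rewrite flipP rpredMsign sD_real.
by rewrite !inE /= (CrealP r).
Qed.

(* The characters of the Galois group of F, in additive notation. *)
Definition chi (S A : {set 'I_t}) : bool :=
  \big[addb/false]_j ((j \in S) && (j \in A)).

Lemma chiC S A : chi S A = chi A S.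
Proof. by apply: eq_bigr => j _; rewrite andbC. Qed.

Lemma chi_symdiff S A B : chi S (symdiff A B) = chi S A (+) chi S B.
Proof.
by rewrite /chi -big_split; apply: eq_bigr => j _; rewrite inE andb_addr.
Qed.

Lemma chi0 S : chi S set0 = false.
Proof. by rewrite /chi big1 // => j _; rewrite inE andbF. Qed.

Lemma chi1 S j : chi S [set j] = (j \in S).
Proof.
rewrite /chi (bigD1 j) //= inE eqxx andbT big1 ?addbF // => i ij.
by rewrite inE (negbTE ij) andbF.
Qed.

(* Membership in F. *)
Definition fixed (x : algC) := forall nu : aut, flip nu = set0 -> nu x = x.

(** Both [nu \o nu] and [nu \o mu] act trivially on F, hence fix [x]; then [nu] is cancelled. *)
Lemma fixed_eq x (nu mu : aut) : fixed x -> flip nu = flip mu -> nu x = mu x.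
Proof.
move=> fx e; apply: (fmorph_inj nu).
have := fx (nu \o nu); rewrite flip_comp symdiffAA => /(_ erefl) /= ->.
by have := fx (nu \o mu); rewrite flip_comp e symdiffAA => /(_ erefl) /= ->.
Qed.

(** The [sD j] are real, so composing [nu] with complex conjugation does not change its action on
    F. *)
Lemma fixed_real x (nu : aut) : fixed x -> nu x \is Num.real.
Proof.
move=> fx; apply/CrealP.
by apply: (fixed_eq (nu := Num.conj \o nu) fx); exact: flip_conj.
Qed.

(** Positivity concerns the given embedding in [algC] only; total positivity is expressed as
    [0 < nu w] for all [nu]. *)
Definition posunit (w : algC) :=
  [/\ 0 < w, w \in Aint, w^-1 \in Aint & fixed w].

Lemma posunit1 : posunit 1.
Proof. by split; rewrite ?invr1 ?Aint1 // => nu _; rewrite rmorph1. Qed.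

Lemma posunitM x y : posunit x -> posunit y -> posunit (x * y).
Proof.
move=> [x0 xA xA' xF] [y0 yA yA' yF]; split; rewrite ?mulr_gt0 ?invfM ?rpredM //.
by move=> nu e; rewrite rmorphM xF ?yF.
Qed.

Lemma posunitV x : posunit x -> posunit x^-1.
Proof.
move=> [x0 xA xA' xF]; split; rewrite ?invr_gt0 ?invrK //.
by move=> nu e; rewrite fmorphV xF.
Qed.

Lemma posunitX x n : posunit x -> posunit (x ^+ n).
Proof.
move=> ux; elim: n => [|n IH]; first exact: posunit1.
by rewrite exprS; apply: posunitM.
Qed.

Lemma posunitXz x (k : int) : posunit x -> posunit (x ^ k).
Proof. by case: k => n ux; [|apply: posunitV]; apply: posunitX. Qed.

Lemma posunit_prod (I : finType) (P : pred I) (F : I -> algC) :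
  (forall i, P i -> posunit (F i)) -> posunit (\prod_(i | P i) F i).
Proof.
by move=> uF; elim/big_ind: _ => //; [exact: posunit1 | exact: posunitM].
Qed.

(* The positive units of norm 1 of the quadratic subfield of F that is fixed by
   the kernel of [chi S]; for [S = [set j]] this is Q(sqrt(p_j q_j)). *)
Definition twisted S (u : algC) := [/\ 0 < u, u \in Aint, u^-1 \in Aint &
  forall nu : aut, nu u = if chi S (flip nu) then u^-1 else u].

Lemma twisted_posunit S u : twisted S u -> posunit u.
Proof. by case=> u0 uA uA' uF; split=> // nu e; rewrite uF e chi0. Qed.

Lemma twisted1 S : twisted S 1.
Proof. by split; rewrite ?invr1 ?Aint1 // => nu; rewrite rmorph1 if_same. Qed.

Lemma twistedM S x y : twisted S x -> twisted S y -> twisted S (x * y).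
Proof.
move=> [x0 xA xA' xF] [y0 yA yA' yF]; split; rewrite ?mulr_gt0 ?invfM ?rpredM //.
by move=> nu; rewrite rmorphM xF yF; case: ifP => // _; rewrite invfM.
Qed.

Lemma twistedV S x : twisted S x -> twisted S x^-1.
Proof.
move=> [x0 xA xA' xF]; split; rewrite ?invr_gt0 ?invrK //.
by move=> nu; rewrite fmorphV xF; case: ifP => _; rewrite ?invrK.
Qed.

Lemma twisted_totpos S u (nu : aut) : twisted S u -> 0 < nu u.
Proof. by case=> u0 _ _ ->; case: ifP => _; rewrite ?invr_gt0. Qed.

Lemma twisted_trace S u : twisted S u -> exists n : nat, u + u^-1 = n%:R.
Proof.
move=> [u0 uA uA' uF]; apply: Crat_Aint_nat.
- apply: fixed_Crat => nu; rewrite rmorphD fmorphV uF.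
  by case: ifP => _ //; rewrite invrK addrC.
- by rewrite rpredD.
- by rewrite addr_ge0 ?invr_ge0 ?ltW.
Qed.

(** Such a [u] is rational, so [u] and [u^-1] are both natural numbers. *)
Lemma twisted0 u : twisted set0 u -> u = 1.
Proof.
move=> [u0 uA uA' uF]; have fu (nu : aut) : nu u = u by rewrite uF chiC chi0.
have uQ : u \in Crat by exact: fixed_Crat.
have [n Dn] := Crat_Aint_nat uQ uA (ltW u0).
have [m Dm] : exists m : nat, u^-1 = m%:R.
  by apply: Crat_Aint_nat; rewrite ?rpredV ?invr_ge0 ?ltW.
have : (n * m)%:R = 1 :> algC by rewrite natrM -Dn -Dm divff // gt_eqF.
by move/eqP; rewrite pnatr_eq1 muln_eq1 => /andP[/eqP n1 _]; rewrite Dn n1.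
Qed.

(* Descent on the positive integer u + u^-1: a generator is a u > 1 minimizing
   it, or 1 if there is none. *)
Lemma twisted_generator S :
  exists g, twisted S g /\ forall u, twisted S u -> exists k : int, u = g ^ k.
Proof.
have [[u [tu u1]]|no] := pselect (exists u, twisted S u /\ 1 < u); last first.
  exists 1; split=> [|u tu]; first exact: twisted1.
  have u_gt0 : 0 < u by case: tu.
  exists 0; rewrite expr0z.
  have [lt|lt|->//] := real_ltgtP (gtr0_real u_gt0) (gtr0_real ltr01).
    by case: no; exists u^-1; split; [exact: twistedV | rewrite invf_gt1].
  by case: no; exists u.
pose P n := `[< exists u, [/\ twisted S u, 1 < u & u + u^-1 = n%:R] >].
have exP : exists n, P n.
  by have [n Dn] := twisted_trace tu; exists n; apply/asboolP; exists u.
case: (ex_minnP exP) => m /asboolP[g [tg g1 Dg]] min_m; exists g; split=> // v tv.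
have g_gt0 := lt_trans ltr01 g1; have g_neq0 : g != 0 by rewrite gt_eqF.
have pos n : forall v, twisted S v -> 1 <= v -> v + v^-1 = n%:R ->
    exists k : int, v = g ^ k.
  elim/ltn_ind: n => n IH {}v {}tv v1 Dv.
  have v_gt0 := lt_le_trans ltr01 v1.
  move: v1; rewrite le_eqVlt => /predU1P[<-|v1]; first by exists 0; rewrite expr0z.
  have gv : g <= v.
    rewrite real_leNgt ?gtr0_real //; apply/negP => vg.
    have := ltr_add_inv (ltW v1) vg; rewrite Dg Dv ltr_nat ltnNge min_m //.
    by apply/asboolP; exists v.
  have tvg : twisted S (v / g) by apply: twistedM tv (twistedV tg).
  have [n' Dn'] := twisted_trace tvg.
  have vg1 : 1 <= v / g by rewrite ler_pdivlMr ?mul1r.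
  have lt_n : (n' < n)%N.
    rewrite -(ltr_nat algC) -Dn' -Dv ltr_add_inv //.
    by rewrite ltr_pdivrMr // ltr_pMr.
  have [k Dk] := IH n' lt_n _ tvg vg1 Dn'.
  by exists (k + 1); rewrite expfzDr // expr1z -Dk divfK.
have v_gt0 : 0 < v by case: tv.
have [n Dn] := twisted_trace tv.
have [lt|le] := real_ltP (gtr0_real v_gt0) (gtr0_real ltr01); last exact: pos Dn.
have [|||k Dk] := pos n v^-1; rewrite ?invrK //.
- exact: twistedV.
- by rewrite ltW // invf_gt1.
- by rewrite addrC.
by exists (- k); rewrite -invr_expz -Dk invrK.
Qed.

Definition gen S : algC := sval (cid (twisted_generator S)).

Lemma gen_twisted S : twisted S (gen S).
Proof. by rewrite /gen; case: cid => g []. Qed.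

Lemma genP S u : twisted S u -> exists k : int, u = gen S ^ k.
Proof. by rewrite /gen; case: cid => g [_] /= h; apply: h. Qed.

(** * Decomposition of the units of F under the characters of its Galois group *)

Definition sg (b : bool) (x : algC) := if b then x^-1 else x.

Lemma sg_addb b c x : sg (b (+) c) x = sg b (sg c x).
Proof. by case: b; case: c; rewrite /= ?invrK. Qed.

Lemma sg_prod (I : finType) (F : I -> algC) b :
  \prod_i sg b (F i) = sg b (\prod_i F i).
Proof. by case: b => //=; rewrite prodfV. Qed.

(* The image of w under the idempotent (up to the factor 2^t) of [chi S]; its
   sign is not controlled, so that only its square is [twisted]. *)
Definition twist S w := \prod_A sg (chi S A) (rep A w).

(** Translating the index by [flip nu] permutes the conjugates of [w] and shifts the character by
    the constant [chi S (flip nu)]. *)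
Lemma twist_aut S w (nu : aut) :
  fixed w -> nu (twist S w) = sg (chi S (flip nu)) (twist S w).
Proof.
move=> fw; rewrite -sg_prod rmorph_prod [RHS](reindex_inj (can_inj (symdiffK (flip nu)))).
apply: eq_bigr => A _; rewrite -sg_addb chi_symdiff addbC addbK.
have -> : nu (sg (chi S A) (rep A w)) = sg (chi S A) (nu (rep A w)).
  by case: (chi S A); rewrite //= fmorphV.
congr (sg _ _); apply: (fixed_eq (nu := nu \o rep A) fw).
by rewrite flip_comp !flip_rep symdiffC.
Qed.

Lemma twisted_twist S w : posunit w -> twisted S (twist S w ^+ 2).
Proof.
move=> [w0 wA wA' fw].
have sgA b A : sg b (rep A w) \in Aint.
  by case: b; rewrite /= -?fmorphV Aint_aut.
have tw_neq0 : twist S w != 0.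
  by apply/prodf_neq0 => A _; case: (chi S A); rewrite /= ?invr_eq0 fmorph_eq0 gt_eqF.
have tw_real : twist S w \is Num.real.
  by apply: rpred_prod => A _; case: (chi S A); rewrite /= ?rpredV fixed_real.
split.
- by rewrite lt_def sqrf_eq0 tw_neq0 -realEsqr.
- by rewrite rpredX // rpred_prod.
- rewrite -exprVn rpredX // -prodfV rpred_prod // => A _.
  by have := sgA (~~ chi S A) A; case: (chi S A); rewrite /= ?invrK.
by move=> nu; rewrite rmorphXn /= twist_aut //; case: (chi _ _); rewrite //= exprVn.
Qed.

(** Orthogonality of characters, written multiplicatively: if [j] is in [A], toggling [j] in [S]
    inverts every factor, so the unsquared product equals its own inverse. *)
Lemma prod_sg_sqr A (x : algC) : x != 0 ->
  \prod_S sg (chi S A) x ^+ 2 = if A == set0 then x ^+ (2 * 2 ^ t) else 1.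
Proof.
move=> x0; case: eqP => [->|/eqP/set0Pn[j jA]].
  under eq_bigr => S _ do rewrite chi0.
  rewrite prodr_const exprM; congr (_ ^+ _).
  have -> : (2 ^ t)%N = #|powerset [set: 'I_t]| by rewrite card_powerset cardsT card_ord.
  by apply: eq_card => S; rewrite !inE subsetT.
set P := (\prod_S sg (chi S A) x).
have P0 : P != 0.
  by apply/prodf_neq0 => S _; case: (chi S A); rewrite /= ?invr_eq0.
have DP : P = P^-1.
  rewrite {1}/P (reindex_inj (can_inj (symdiffK [set j]))) -[RHS]/(sg true P) -sg_prod.
  apply: eq_bigr => S _; rewrite -sg_addb; congr (sg _ x).
  by rewrite chiC chi_symdiff chi1 jA addbC chiC.
by rewrite prodrXl -/P expr2 {1}DP mulVf.
Qed.

(** In the product of all squared twists, orthogonality leaves only the conjugate at [set0], that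
    is, [w] itself. The exponent is 2 from squaring times the number [2 ^ t] of characters. *)
Lemma posunit_pow w : posunit w ->
  exists a : {set 'I_t} -> int,
    w ^+ (2 * 2 ^ t) = \prod_(S | S != set0) gen S ^ a S.
Proof.
move=> uw; have w0 : w != 0 by case: uw => w0 *; rewrite gt_eqF.
have [a Da] := boolp.choice (fun S => genP (twisted_twist S uw)).
exists a; transitivity (\prod_S twist S w ^+ 2).
  under [RHS]eq_bigr => S _ do rewrite -prodrXl.
  rewrite exchange_big /= (bigD1 set0) //= prod_sg_sqr ?fmorph_eq0 // eqxx.
  rewrite big1 ?mulr1 => [|A /negbTE A0]; last by rewrite prod_sg_sqr ?fmorph_eq0 // A0.
  by case: uw => _ _ _ -> //; rewrite flip_rep.
rewrite (bigD1 set0) //= (twisted0 (twisted_twist _ uw)) mul1r.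
by apply: eq_bigr.
Qed.

(** * Independence modulo squares of the units of the Q(sqrt(p_j q_j)) *)

Hypotheses (p3 : forall j, (p j %% 4 = 3)%N) (q3 : forall j, (q j %% 4 = 3)%N).
Hypotheses (p_inj : injective p) (q_inj : injective q) (neq_pq : forall i j, p i != q j).

Section QuadraticUnit.

Variables (j : 'I_t) (g : algC).
Hypotheses (tg : twisted [set j] g) (g_neq1 : g != 1).

Lemma twisted1P (nu : aut) : nu g = if j \in flip nu then g^-1 else g.
Proof. by case: tg => _ _ _ ->; rewrite chiC chi1. Qed.

(** [N] is the trace of [g] plus 2. The root [r] is, up to sign, [(g - g^-1) * sD j], which is
    rational because its two factors change sign together. *)
Lemma quadratic_norm : exists N : nat,
  [/\ (4 < N)%N, (1 + g) ^+ 2 = N%:R * g &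
      exists r : nat, (N * (N - 4) * (p j * q j) = r ^ 2)%N].
Proof.
have g_gt0 : 0 < g by case: tg.
have g0 : g != 0 by rewrite gt_eqF.
have [T DT] := twisted_trace tg.
have T2 : (T + 2)%:R - 4%:R = (g - 1) ^+ 2 / g.
  by rewrite natrD -DT; field.
have N4 : (4 < T + 2)%N.
  rewrite -(ltr_nat algC) -subr_gt0 T2 divr_gt0 // lt_def sqrf_eq0 subr_eq0 g_neq1.
  by rewrite -realEsqr rpredB ?gtr0_real.
exists (T + 2)%N; split=> //.
  by rewrite natrD -DT; field.
apply: (@Crat_sqr_natr ((g - g^-1) * sD j)).
  apply: fixed_Crat => nu; rewrite rmorphM rmorphB fmorphV twisted1P flipP.
  by case: (j \in flip nu); rewrite ?expr0 ?expr1 ?invrK; ring.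
by rewrite exprMn sD_sq !natrM natrB ?(ltnW N4) // T2 natrD -DT; field.
Qed.

Lemma even_logn_norm N l : (4 < N)%N -> (1 + g) ^+ 2 = N%:R * g ->
  prime l -> odd l -> l != p j -> l != q j -> ~~ odd (logn l N).
Proof.
move=> N4 DN; have [N' [_ DN' [r Dr]]] := quadratic_norm.
have g0 : g != 0 by case: tg => g_gt0 *; rewrite gt_eqF.
have /eqP : N%:R = N'%:R :> algC by apply: (mulIf g0); rewrite -DN DN'.
rewrite eqr_nat => /eqP e; rewrite -e in Dr => pr_l od_l lp lq.
exact: even_logn N4 Dr _ pr_l od_l lp lq.
Qed.

(** Equal parities make [N] a square [x ^ 2], and the root is [h = (1 + g) / x]. It is a unit
    because [h] and [h^-1] are both roots of the monic polynomial [X^2 - x X + 1]. *)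
Lemma sqrt_of_eq_parity N : (4 < N)%N -> (1 + g) ^+ 2 = N%:R * g ->
  odd (logn (p j) N) = odd (logn (q j) N) ->
  exists h, twisted [set j] h /\ h ^+ 2 = g.
Proof.
move=> N4 DN; have [N' [_ DN' [r Dr]]] := quadratic_norm.
have g_gt0 : 0 < g by case: tg.
have g0 : g != 0 by rewrite gt_eqF.
have /eqP : N%:R = N'%:R :> algC by apply: (mulIf g0); rewrite -DN DN'.
rewrite eqr_nat => /eqP e; rewrite -e in Dr.
case/(square_of_eq_parity (pr_p j) (pr_q j) (neq_pq j j) (p3 j) (q3 j) N4 Dr) => x Dx.
have x_gt0 : 0 < x%:R :> algC.
  by rewrite ltr0n lt0n; apply: contraTneq N4 => x0; rewrite Dx x0.
have x0 : x%:R != 0 :> algC by rewrite gt_eqF.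
rewrite Dx natrX in DN; pose h := (1 + g) / x%:R.
have Dh : h ^+ 2 = g by rewrite /h expr_div_n DN mulrC mulKf // expf_neq0.
have h_gt0 : 0 < h by rewrite divr_gt0 // addr_gt0.
have h0 : h != 0 by rewrite gt_eqF.
have Dh1 : 1 + g = x%:R * h by rewrite /h mulrC divfK.
have hA (y : algC) : y ^+ 2 + 1 = x%:R * y -> y \in Aint.
  move=> Dy; apply: (@root_monic_Aint ('X^2 - (x%:R *: 'X - 1%:P))).
  - by rewrite /root !hornerE -Dy addrK subrr.
  - rewrite monicE lead_coefDl ?lead_coefXn // size_polyXn size_polyN.
    apply: leq_ltn_trans (size_polyD _ _) _; rewrite gtn_max size_polyN size_polyC oner_eq0.
    by rewrite !ltnS andbT (leq_trans (size_scale_leq _ _)) ?size_polyX.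
  - apply/polyOverP => -[|[|[|i]]]; rewrite !coefE /= !(rpredB, rpredM) //;
    by rewrite ?rpred0 ?rpred1 ?rpred_nat.
have Dhx : h = (1 + g) / x%:R by [].
clearbody h; exists h; split=> //; split=> //.
- by apply: hA; rewrite Dh addrC.
- apply: hA; have -> : h^-1 ^+ 2 + 1 = (1 + h ^+ 2) / h ^+ 2 by field.
  by rewrite {1}Dh Dh1; field.
move=> nu; rewrite chiC chi1 {1}Dhx rmorphM fmorphV rmorph_nat rmorphD rmorph1 twisted1P.
case: (j \in flip nu) => //.
have -> : 1 + g^-1 = x%:R * h^-1.
  apply: (mulfI g0); rewrite mulrDr mulr1 divff // addrC Dh1 -Dh.
  by field.
by rewrite mulrC mulKf.
Qed.

End QuadraticUnit.

(* Kummer theory for F: v is a rational multiple of the product of sD over R. *)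
Lemma signed_char (v : algC) : v != 0 -> fixed v ->
  (forall nu : aut, nu v = v \/ nu v = - v) ->
  exists R, forall nu : aut, nu v = (-1) ^+ chi R (flip nu) * v.
Proof.
move=> v0 fv sgn_v; pose c A := rep A v != v.
have cE (nu : aut) : nu v = (-1) ^+ c (flip nu) * v.
  rewrite (fixed_eq (mu := rep (flip nu)) fv) ?flip_rep //.
  rewrite /c; case: eqVneq => [->|]; first by rewrite mul1r.
  by case: (sgn_v (rep (flip nu))) => ->; rewrite ?eqxx ?mulN1r.
have cD A B : c (symdiff A B) = c A (+) c B.
  have := cE (rep A \o rep B); rewrite flip_comp !flip_rep /= cE flip_rep.
  rewrite rmorphM rmorphXn rmorphN1 cE flip_rep mulrA -signr_addb => /(mulIf v0)/eqP.
  rewrite addbC; case: (c A (+) c B); case: (c _) => //=; rewrite ?expr0 ?expr1.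
    by rewrite eq_sym -subr_eq0 opprK -mulr2n pnatr_eq0.
  by rewrite -subr_eq0 opprK -mulr2n pnatr_eq0.
(* By [cD] the sign is a character, determined by its values at singletons; the induction removes
   one element of [A] at a time. *)
exists [set j | c [set j]] => nu; rewrite cE; congr ((-1) ^+ (nat_of_bool _) * v).
move: (flip nu) => A; have [n leAn] := ubnP #|A|; elim: n A leAn => // n IH A leAn.
have [->|[j jA]] := set_0Vmem A.
  by have := cD set0 set0; rewrite symdiffAA addbb chi0.
have DA : A = symdiff (A :\ j) [set j].
  by apply/setP => i; rewrite !inE; case: eqVneq => [->|_]; rewrite ?jA // andTb addbF.
rewrite DA cD chi_symdiff chi1 inE -IH // -ltnS.
by rewrite (cardsD1 j) jA in leAn.
Qed.

(** Given a root [y], the quotient [v] of the product of the [1 + g j] by [y] is a square root in F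
    of a natural number, hence a rational multiple of a product of [sD]. Comparing valuations at
    [p j0] and [q j0] then gives [g j0] a root among the powers of [g j0], forcing [g j0 = 1]. *)
Lemma gen_prod_nonsquare (S : {set 'I_t}) y :
  (forall j, j \in S -> gen [set j] != 1) -> posunit y ->
  y ^+ 2 = \prod_(j in S) gen [set j] -> S = set0.
Proof.
move=> gS uy Dy; apply/eqP; apply: contraT => /set0Pn[j0 j0S].
pose g j := gen [set j]; have tg j : twisted [set j] (g j) := gen_twisted _.
have g_gt0 j : 0 < g j by case: (tg j).
have [N DN] := boolp.choice (fun j => twisted_trace (tg j)).
have NP j : j \in S -> (4 < N j + 2)%N /\ (1 + g j) ^+ 2 = (N j + 2)%:R * g j.
  move=> jS; have [N' [N4 DN' _]] := quadratic_norm (tg j) (gS _ jS).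
  have DNj : (1 + g j) ^+ 2 = (N j + 2)%:R * g j.
    by rewrite natrD -DN; field; rewrite gt_eqF.
  split=> //; suff <- : N' = (N j + 2)%N by [].
  apply/eqP; rewrite -(eqr_nat algC); apply/eqP.
  by apply: (mulIf (_ : g j != 0)); rewrite ?gt_eqF // -DNj -DN'.
have y_gt0 : 0 < y by case: uy.
have fy : fixed y by case: uy.
pose v := \prod_(j in S) (1 + g j) / y.
have v_gt0 : 0 < v by rewrite divr_gt0 // prodr_gt0 // => j _; rewrite addr_gt0.
have Dv : v ^+ 2 = (\prod_(j in S) (N j + 2))%:R.
  rewrite expr_div_n Dy -prodrXl natr_prod -prodf_div; apply: eq_bigr => j jS.
  by have [_ ->] := NP j jS; rewrite mulfK // gt_eqF.
have fv : fixed v.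
  move=> nu e; rewrite fmorph_div fy // rmorph_prod; congr (_ / _).
  by apply: eq_bigr => j _; rewrite rmorphD rmorph1 (twisted1P (tg j)) e inE.
have sgn_v (nu : aut) : nu v = v \/ nu v = - v.
  have /eqP : nu v ^+ 2 = v ^+ 2 by rewrite -rmorphXn Dv rmorph_nat.
  by rewrite eqf_sqr => /orP[] /eqP ->; [left | right].
have [R DR] := signed_char (lt0r_neq0 v_gt0) fv sgn_v.
pose delta := \prod_(j in R) sD j.
have Ddelta (nu : aut) : nu delta = (-1) ^+ chi R (flip nu) * delta.
  rewrite rmorph_prod (eq_bigr _ (fun j _ => flipP nu j)) big_split /=; congr (_ * _).
  rewrite /chi [RHS](big_morph (fun b : bool => (-1) ^+ b) (id1 := 1) (op1 := *%R)) //;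
    last exact: signr_addb.
  by rewrite big_mkcond; apply: eq_bigr => j _; case: (j \in R).
have vdQ : v * delta \in Crat.
  by apply: fixed_Crat => nu; rewrite rmorphM DR Ddelta mulrACA -expr2 sqrr_sign mul1r.
have vd2 : (v * delta) ^+ 2 = (\prod_(j in S) (N j + 2) * \prod_(j in R) (p j * q j))%:R.
  rewrite exprMn Dv natrM; congr (_ * _).
  by rewrite -prodrXl natr_prod; apply: eq_bigr => j _.
have [r Dr] := Crat_sqr_natr vdQ vd2.
(* In [Dr], the only factors that can have odd valuation at such an [l] are those of index [j0]. *)
have parity l : prime l -> odd l ->
    (forall j, j != j0 -> l != p j /\ l != q j) -> (l == p j0) (+) (l == q j0) ->
    odd (logn l (N j0 + 2)) = (j0 \in R).
  move=> pr_l od_l l_other l_j0; have := congr1 (fun n => odd (logn l n)) Dr.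
  have N0 j : j \in S -> (0 < N j + 2)%N by rewrite addn2.
  have pq0 j : (0 < p j * q j)%N by rewrite muln_gt0 !prime_gt0.
  rewrite lognX mul2n odd_double lognM ?prodn_cond_gt0 // oddD !odd_logn_prod //.
  rewrite (bigD1 j0) //= [X in _ (+) X (+) _]big1 ?addbF;
    last move=> j /andP[jS /l_other[lp lq]]; last first.
    by have [N4 DNj] := NP j jS; apply/negbTE/(even_logn_norm (tg j) (gS j jS) N4 DNj).
  have lpq j : odd (logn l (p j * q j)) = (j == j0).
    rewrite lognM ?prime_gt0 // (logn_prime _ (pr_p j)) (logn_prime _ (pr_q j)) oddD !oddb.
    have [->|/l_other[/negbTE-> /negbTE->] //] := eqVneq j j0; exact: l_j0.
  rewrite (eq_bigr _ (fun j _ => lpq j)); have [j0R|j0R] := boolP (j0 \in R).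
    rewrite (bigD1 j0) //= eqxx big1 => [|j /andP[_ /negbTE]//].
    by rewrite addbF addbT => /negbFE.
  rewrite big1 ?addbF // => j jR; apply: contraNF j0R => /eqP <-.
  exact: jR.
have odd3 l : (l %% 4 = 3)%N -> odd l by lia.
have [N4 DN0] := NP j0 j0S.
have [|h [th Dh]] := sqrt_of_eq_parity (tg j0) (gS _ j0S) N4 DN0.
  rewrite !parity ?odd3 //.
  - by move=> j jj0; rewrite (inj_eq q_inj) (eq_sym j0) jj0 (eq_sym (q j0)) neq_pq.
  - by rewrite eqxx eq_sym (negbTE (neq_pq _ _)).
  - by move=> j jj0; rewrite (inj_eq p_inj) (eq_sym j0) jj0 neq_pq.
  - by rewrite eqxx (negbTE (neq_pq _ _)).
have [k Dk] := genP th; rewrite -/(g j0) in Dk.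
have g0 : g j0 != 0 by rewrite gt_eqF.
have : g j0 ^ (k * 2 - 1) = 1.
  by rewrite expfzDr // -exprz_exp -Dk /= -exprnP Dh exprN1 mulfV.
move/(expz_eq1_pos (g_gt0 j0)) => h1; move: (gS _ j0S); rewrite -/(g j0) h1 ?eqxx //.
by lia.
Qed.

(** Dividing [y] by the generators to the halved exponents leaves a root of the product of those
    with odd exponent. *)
Lemma gen_exp_even (b : 'I_t -> int) y : posunit y ->
  y ^+ 2 = \prod_j gen [set j] ^ b j ->
  forall j, gen [set j] != 1 -> ~~ odd `|b j|.
Proof.
move=> uy Dy; have [h Dh] := boolp.choice (fun j => int_halve (b j)).
have gu j : posunit (gen [set j]) := twisted_posunit (gen_twisted _).
have g0 j : gen [set j] != 0 by case: (gu j) => g_gt0 *; rewrite gt_eqF.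
pose S := [set j | (gen [set j] != 1) && odd `|b j|].
suff S0 : S = set0.
  move=> j gj; apply/negP => od; have jS : j \in S by rewrite inE gj.
  by rewrite S0 inE in jS.
apply: (@gen_prod_nonsquare _ (y / \prod_j gen [set j] ^ h j)).
- by move=> j; rewrite inE => /andP[].
- by apply/posunitM/posunitV/posunit_prod => // j _; apply: posunitXz.
rewrite expr_div_n Dy -prodrXl -prodf_div [RHS]big_mkcond; apply: eq_bigr => j _.
rewrite inE {1}Dh exprzDr ?unitfE // exprnP exprz_exp mulfK ?expfz_neq0 //.
by case: eqVneq => [->|_] /=; [rewrite exp1rz | case: odd].
Qed.

(* The exponents B j with g_j <> 1 are even by independence, and those with
   g_j = 1 do not matter, so that the square root can be taken m times. *)
Lemma root_gen_totpos m W (B : 'I_t -> int) (nu : aut) : posunit W ->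
  W ^+ (2 ^ m) = \prod_j gen [set j] ^ B j -> 0 < nu W.
Proof.
move=> uW; have W_gt0 : 0 < W by case: uW.
elim: m B => [|m IH] B.
  rewrite expr1 => ->; rewrite rmorph_prod prodr_gt0 // => j _.
  by rewrite fmorphXz exprz_gt0 // (twisted_totpos _ (gen_twisted _)).
rewrite expnSr exprM => DW; have [h Dh] := boolp.choice (fun j => int_halve (B j)).
have g_gt0 j : 0 < gen [set j] by case: (gen_twisted [set j]).
apply: (IH h); apply/eqP; rewrite -(eqrXn2 (n := 2)) //; last 2 first.
- by rewrite exprn_ge0 // ltW.
- by rewrite prodr_ge0 // => j _; rewrite exprz_ge0 // ltW.
rewrite DW -prodrXl; apply/eqP/eq_bigr => j _.
have [->|gj] := eqVneq (gen [set j]) 1; first by rewrite !exp1rz expr1n.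
have := gen_exp_even (posunitX _ uW) DW gj; rewrite {2}Dh => /negbTE->.
by rewrite add0r exprnP exprz_exp.
Qed.

(** * Bound on the signature rank of F *)

Lemma card_set_gt1 : #|[set S : {set 'I_t} | 1 < #|S|]%N| = (2 ^ t - 1 - t)%N.
Proof.
have -> : [set S : {set 'I_t} | 1 < #|S|]%N = ~: (set0 |: [set [set j] | j in 'I_t]).
  apply/setP=> S; rewrite !inE ltnNge; congr (~~ _).
  apply/idP/orP => [|[/eqP->|/imsetP[j _ ->]]]; rewrite ?cards0 ?cards1 //.
  rewrite leq_eqVlt ltnS leqn0 cards_eq0 => /orP[/cards1P[j ->]|->]; last by left.
  by right; apply: imset_f.
rewrite cardsCs setCK cardsU1 card_imset; last exact: set1_inj.
have -> : set0 \notin [set [set j] | j in 'I_t].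
  by apply/imsetP => -[j _ /setP/(_ j)]; rewrite !inE eqxx.
have -> : #|{set 'I_t}| = (2 ^ t)%N.
  rewrite -[in RHS](card_ord t) -[in RHS]cardsT -card_powerset; apply: eq_card => S.
  by rewrite !inE subsetT.
by rewrite card_ord subnDA.
Qed.

(** For larger [s], a relation [c] with an odd entry cancels the exponents of all [gen S] with [S]
    of at least two elements. Then [W] is totally positive, and modulo squares it is the product of
    the [w i] with [c i] odd. *)
Lemma signature_bound s (w : 'I_s -> algC) :
  (forall i, posunit (w i)) ->
  (forall I : {set 'I_s}, (forall nu : aut, 0 < nu (\prod_(i in I) w i)) -> I = set0) ->
  (s <= 2 ^ t - 1 - t)%N.
Proof.
move=> uw indep; rewrite leqNgt -card_set_gt1; apply/negP => lt_s.
set X := [set S : {set 'I_t} | _] in lt_s.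
have [a Da] := boolp.choice (fun i => posunit_pow (uw i)).
have [c [[i0 od] rel]] := odd_int_relation (\matrix_(i, k) a i (enum_val k)) lt_s.
have w0 i : w i != 0 by case: (uw i) => w_gt0 *; rewrite gt_eqF.
have g0 S : gen S != 0 by case: (gen_twisted S) => g_gt0 *; rewrite gt_eqF.
pose W := \prod_i w i ^ c i.
have uW : posunit W by apply: posunit_prod => i _; apply: posunitXz.
pose E S := \sum_i a i S * c i.
have E0 S : S \in X -> E S = 0.
  move=> XS; rewrite -[RHS](rel (enum_rank_in XS S)); apply: eq_bigr => i _.
  by rewrite mxE enum_rankK_in // mulrC.
have DW : W ^+ (2 ^ t.+1) = \prod_j gen [set j] ^ E [set j].
  transitivity (\prod_(S | S != set0) gen S ^ E S).
    rewrite expnS -prodrXl.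
    transitivity (\prod_i \prod_(S | S != set0) gen S ^ (a i S * c i)).
      apply: eq_bigr => i _; rewrite exprnP exprzAC -exprnP Da.
      rewrite (big_morph (fun x => x ^ c i) (id1 := 1) (op1 := *%R)) ?exp1rz //; last first.
        by move=> x y; rewrite expfzMl.
      by apply: eq_bigr => S _; rewrite exprz_exp.
    rewrite exchange_big /=; apply: eq_bigr => S _.
    rewrite /E (big_morph (fun k : int => gen S ^ k) (id1 := 1) (op1 := *%R)) ?expr0z // => k l.
    by rewrite expfzDr.
  rewrite (bigID (mem [set [set j] | j in 'I_t])) /= [X in _ * X]big1 ?mulr1; last first.
    move=> S /andP[S0 S1]; rewrite E0 ?expr0z // inE ltnNge; apply: contra S1.
    rewrite leq_eqVlt ltnS leqn0 cards_eq0 (negbTE S0) orbF => /cards1P[j ->].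
    exact: imset_f.
  rewrite -(big_imset (fun S => gen S ^ E S) (in2W set1_inj)) /=; apply: eq_bigl => S.
  apply/andb_idl => /imsetP[j _ ->]; apply/eqP => /setP/(_ j).
  by rewrite !inE eqxx.
have [h Dh] := boolp.choice (fun i => int_halve (c i)).
suff /setP/(_ i0) : [set i | odd `|c i|] = set0 by rewrite !inE od.
apply: indep => nu.
have -> : \prod_(i in [set i | odd `|c i|]) w i = W / (\prod_i w i ^ h i) ^+ 2.
  rewrite -prodrXl -prodf_div [LHS]big_mkcond; apply: eq_bigr => i _.
  rewrite inE {2}Dh expfzDr // exprnP exprz_exp mulfK ?expfz_neq0 //.
  by case: odd.
rewrite fmorph_div rmorphXn divr_gt0 ?(root_gen_totpos _ uW DW) //.
set Y := \prod_i _; have uY : posunit Y by apply: posunit_prod => i _; apply: posunitXz.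
rewrite lt_def sqrf_eq0 fmorph_eq0 -realEsqr.
by case: uY => Y0 _ _ fY; rewrite gt_eqF //= fixed_real.
Qed.

End Multiquadratic.

(** * Cyclotomic fields *)

(** Both sides are the value at 1 of the quotient of [X^p - 1] by [X - 1]. *)
Lemma prod_sub_prim_root (R : fieldType) (p : nat) (zeta : R) :
  (0 < p)%N -> p.-primitive_root zeta -> \prod_(1 <= k < p) (1 - zeta ^+ k) = p%:R.
Proof.
move=> p_gt0 prim.
have e : \prod_(1 <= k < p) ('X - (zeta ^+ k)%:P) = \sum_(i < p) 'X^i.
  have X1 : 'X - 1 != 0 :> {poly R} by rewrite -polyC1 polyXsubC_eq0.
  apply: (mulfI X1); rewrite -[RHS](subrX1 ('X : {poly R}) p).
  by have := factor_Xn_sub_1 prim; rewrite big_ltn // expr0 polyC1.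
transitivity (\prod_(1 <= k < p) ('X - (zeta ^+ k)%:P).[1]).
  by apply: eq_bigr => k _; rewrite hornerXsubC.
rewrite -horner_prod e horner_sum; under eq_bigr => k _ do rewrite hornerXn expr1n.
by rewrite sumr_const card_ord.
Qed.

(* A square root of -p when p = 3 mod 4 is prime and xi is a primitive p-th root
   of unity: p is the product of the 1 - xi^(2k), and the factors at k and p - k
   together give -(xi^k - xi^-k)^2. *)
Definition sqrt_prod (p : nat) (xi : algC) :=
  \prod_(1 <= k < (p.-1)./2.+1) (xi ^+ k - xi ^- k).

Section SqrtNegPrime.

Variables (p : nat) (xi : algC).
Hypotheses (pr_p : prime p) (p3 : (p %% 4 = 3)%N) (prim : p.-primitive_root xi).

Lemma sqrt_prod_sqr : sqrt_prod p xi ^+ 2 = - p%:R.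
Proof.
set m := (p.-1)./2; have [Dp od_m] : p = (m + m).+1 /\ odd m by rewrite /m; lia.
have xi0 : xi != 0 by rewrite (prim_root_eq0 prim) -lt0n prime_gt0.
have prim2 : p.-primitive_root (xi ^+ 2).
  by rewrite prim_root_exp_coprime // coprime2n Dp /= addnn odd_double.
have := prod_sub_prim_root (prime_gt0 pr_p) prim2.
rewrite (big_cat_nat (n := m.+1)) //=; last by rewrite Dp ltnS leq_addr.
move=> <-.
have -> : \prod_(m.+1 <= k < p) (1 - xi ^+ 2 ^+ k) =
          \prod_(1 <= k < m.+1) (1 - xi ^- 2 ^+ k).
  rewrite -[m.+1]add1n big_addn big_nat_rev /=.
  have -> : (p - m = m.+1)%N by rewrite Dp subSn ?addnK // leq_addr.
  rewrite add1n; apply: eq_big_nat => i /andP[i1 im]; congr (1 - _).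
  have -> : (1 + m.+1 - i.+1 + m = p - i)%N by rewrite Dp; lia.
  have x2 : xi ^+ 2 ^+ i != 0 by rewrite !expf_neq0.
  apply: (mulIf x2); rewrite -exprD subnK; last by rewrite Dp; lia.
  by rewrite exprVn mulVf // (prim_expr_order prim2).
rewrite -big_split -prodrXl /=.
have sgn : -1 = \prod_(1 <= k < m.+1) (-1) :> algC.
  by rewrite prodr_const_nat subSS subn0 -signr_odd od_m expr1.
rewrite -[RHS]mulN1r [X in _ = X * _]sgn -big_split.
apply: eq_bigr => k _ /=; have xk : xi ^+ k != 0 by rewrite expf_neq0.
by rewrite exprVn (exprAC xi 2 k); move: (xi ^+ k) xk => y y0; field.
Qed.

Lemma sqrt_prod_fix (nu : aut) : nu xi = xi -> nu (sqrt_prod p xi) = sqrt_prod p xi.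
Proof.
move=> nux; rewrite rmorph_prod; apply: eq_bigr => k _.
by rewrite rmorphB fmorphV rmorphXn /= nux.
Qed.

(** Each factor changes sign, and their number [(p.-1)./2] is odd. *)
Lemma sqrt_prod_flip (nu : aut) : nu xi = xi^-1 -> nu (sqrt_prod p xi) = - sqrt_prod p xi.
Proof.
move=> nux; have od_m : odd (p.-1)./2 by clear - p3; lia.
rewrite rmorph_prod (eq_bigr (fun k => - (xi ^+ k - xi ^- k))) => [|k _]; last first.
  by rewrite rmorphB fmorphV rmorphXn /= nux exprVn invrK opprB.
under eq_bigr => k _ do rewrite -mulN1r.
rewrite big_split prodr_const_nat subSS subn0 -signr_odd od_m.
by rewrite /= expr1 mulN1r.
Qed.

End SqrtNegPrime.

(** * Automorphisms of cyclotomic fields *)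

Section RealCyclotomic.

Variables (n : nat) (z : algC).
Hypotheses (n_gt0 : (0 < n)%N) (prim_z : n.-primitive_root z).

Definition in_cyc (x : algC) := exists P : {poly rat}, x = (map_poly ratr P).[z].

Lemma in_cyc1 : in_cyc 1.
Proof. by exists 1; rewrite rmorph1 hornerC. Qed.

Lemma in_cycz : in_cyc z.
Proof. by exists 'X; rewrite map_polyX hornerX. Qed.

Lemma in_cycB x y : in_cyc x -> in_cyc y -> in_cyc (x - y).
Proof. by move=> [P ->] [Q ->]; exists (P - Q); rewrite rmorphB hornerD hornerN. Qed.

Lemma in_cycM x y : in_cyc x -> in_cyc y -> in_cyc (x * y).
Proof. by move=> [P ->] [Q ->]; exists (P * Q); rewrite rmorphM hornerM. Qed.

Lemma in_cycX x k : in_cyc x -> in_cyc (x ^+ k).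
Proof. by move=> [P ->]; exists (P ^+ k); rewrite rmorphXn horner_exp. Qed.

Lemma in_cyc_prod (I : Type) (r : seq I) (P : pred I) (F : I -> algC) :
  (forall i, P i -> in_cyc (F i)) -> in_cyc (\prod_(i <- r | P i) F i).
Proof.
by move=> inF; elim/big_ind: _ => //; [exact: in_cyc1 | exact: in_cycM].
Qed.

Lemma aut_horner (nu : aut) (P : {poly rat}) x :
  nu (map_poly ratr P).[x] = (map_poly ratr P).[nu x].
Proof.
rewrite -horner_map -map_poly_comp; congr _.[_].
by apply: eq_map_poly => a /=; rewrite fmorph_rat.
Qed.

Lemma aut_prim_root (nu : aut) : exists k, nu z = z ^+ k.
Proof.
have : nu z ^+ n = 1 by rewrite -rmorphXn (prim_expr_order prim_z) rmorph1.
by case/(prim_rootP prim_z) => k ->; exists k.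
Qed.

Lemma in_cyc_aut (nu : aut) x : in_cyc x -> in_cyc (nu x).
Proof.
move=> [P ->]; have [k Dk] := aut_prim_root nu; rewrite aut_horner Dk.
exists (P \Po 'X^k); rewrite map_comp_poly map_polyXn horner_comp hornerXn.
by [].
Qed.

(** On [n]-th roots of unity conjugation is inversion, which commutes with every automorphism. Hence
    the real subfield is stable. *)
Lemma conj_aut (nu : aut) x : in_cyc x -> (nu x)^* = nu x^*.
Proof.
move=> [P ->]; rewrite -[(nu _)^*]/((Num.conj \o nu) _) !aut_horner /=; congr _.[_].
have z0 : z != 0 by rewrite (prim_root_eq0 prim_z) -lt0n.
have cz (y : algC) : y ^+ n = 1 -> y^* = y^-1.
  move=> yn; have y1 : `|y| = 1.
    by apply/eqP; rewrite -(pexpr_eq1 n_gt0) // -normrX yn normr1.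
  by rewrite -[LHS]mul1r -[LHS]/(1 * y^*) invC_norm y1 expr1n invr1.
by rewrite !cz ?fmorphV // -?rmorphXn (prim_expr_order prim_z) ?rmorph1.
Qed.

Lemma in_realcyc_aut (nu : aut) x : in_realcyc z x -> in_realcyc z (nu x).
Proof.
move=> [xz xR]; split; first exact: in_cyc_aut.
by apply/CrealP; rewrite conj_aut // (CrealP xR).
Qed.

Lemma real_embedding_aut (nu : aut) : is_real_embedding z nu.
Proof.
split=> [|x y _ _|x y _ _|x xz]; [exact: rmorph1 | exact: rmorphD | exact: rmorphM |].
by case: (in_realcyc_aut nu xz).
Qed.

(** The automorphism raises [n]-th roots of unity to a power [k] that is -1 modulo the [pi]-part of
    [n] and 1 modulo the rest, by the Chinese remainder theorem. *)
Lemma aut_flip_primes (pi : nat_pred) : exists nu : aut, forall l, prime l -> (l %| n)%N ->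
  let xi := z ^+ (n %/ l) in nu xi = if l \in pi then xi^-1 else xi.
Proof.
pose a := (n`_pi)%N; pose b := (n`_pi^')%N.
have Dn : n = (a * b)%N by rewrite partnC.
have cop_ab : coprime a b := coprime_partC _ _ _.
pose k := chinese a b a.-1 1.
have a_gt0 : (0 < a)%N := part_gt0 _ _.
have ka : k = a.-1 %[mod a] by exact: chinese_modl.
have kb : k = 1 %[mod b] by exact: chinese_modr.
have cop_k : coprime k n.
  rewrite Dn coprimeMr -[coprime k a]coprime_modl ka coprime_modl.
  by rewrite -[coprime k b]coprime_modl kb coprime_modl coprime1n coprimePn ?a_gt0.
have [nu Dnu] := Qn_aut_exists cop_k; exists nu => l pr_l dv xi.
have prim_xi : l.-primitive_root xi by exact: dvdn_prim_root.
have xi_n : xi ^+ n = 1 by rewrite exprAC (prim_expr_order prim_z) expr1n.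
rewrite Dnu //; case: ifP => l_pi.
  have la : (l %| a)%N.
    rewrite (dvdn_trans _ (partn_dvd pi n_gt0 dv)) // part_pnat_id //.
    by rewrite pnatE.
  have xi0 : xi != 0 by rewrite (prim_root_eq0 prim_xi) -lt0n prime_gt0.
  apply: (mulIf xi0); rewrite mulVf // -exprSr.
  apply/eqP; rewrite -(prim_order_dvd prim_xi) (dvdn_trans la) // /dvdn.
  by rewrite -addn1 -modnDml ka modnDml addn1 prednK // modnn.
have lb : (l %| b)%N.
  rewrite (dvdn_trans _ (partn_dvd (negn pi) n_gt0 dv)) // part_pnat_id //.
  by rewrite pnatE // inE /= l_pi.
rewrite -[RHS]expr1; apply/eqP; rewrite (eq_prim_root_expr prim_xi).
by apply/eqP; rewrite -(modn_dvdm k lb) kb modn_dvdm.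
Qed.

End RealCyclotomic.

(** * Descent of signatures *)

Lemma addb_F2 (b c : bool) : (b (+) c)%:R = b%:R + c%:R :> 'F_2.
Proof. by case: b; case: c; apply/eqP. Qed.

Lemma F2_bool (x : 'F_2) : x = 0 \/ x = 1.
Proof. by case: x => -[|[|m]] lt_m //; [left | right]; apply/eqP. Qed.

Lemma mul_lt0_addb (x y : algC) : x \is Num.real -> y \is Num.real ->
  x != 0 -> y != 0 -> (x * y < 0) = (x < 0) (+) (y < 0).
Proof.
move=> xR yR x0 y0; case: (real_ltgt0P xR) x0 => // [x_gt0|x_lt0] _.
  by rewrite pmulr_rlt0.
by rewrite nmulr_rlt0 //; case: (real_ltgt0P yR) y0.
Qed.

Lemma prod_lt0_F2 (I : finType) (P : pred I) (F : I -> algC) :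
  (forall i, P i -> F i \is Num.real /\ F i != 0) ->
  (\prod_(i | P i) F i < 0)%R%:R = \sum_(i | P i) (F i < 0)%R%:R :> 'F_2.
Proof.
move=> FP; suff [] : [/\ \prod_(i | P i) F i \is Num.real, \prod_(i | P i) F i != 0 &
  (\prod_(i | P i) F i < 0)%R%:R = \sum_(i | P i) (F i < 0)%R%:R :> 'F_2] by [].
apply: (big_rec2 (fun x y => [/\ x \is Num.real, x != 0 & (x < 0)%R%:R = y])).
  by rewrite ltr10 rpred1 oner_eq0.
move=> i y x Pi [xR x0 <-].
have [FR F0] := FP i Pi.
by split; [exact: rpredM | exact: mulf_neq0 | rewrite mul_lt0_addb // addb_F2].
Qed.

Section Descent.

Variables (t n : nat) (z : algC) (sD : 'I_t -> algC) (d : nat) (e : 'I_d -> algC -> algC).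
Hypotheses (n_gt0 : (0 < n)%N) (prim_z : n.-primitive_root z) (enum_e : embedding_enum z e).
Variables (p q : 'I_t -> nat).
Hypotheses (pr_p : forall j, prime (p j)) (pr_q : forall j, prime (q j)).
Hypothesis sD_sq : forall j, sD j ^+ 2 = (p j * q j)%:R.
Hypothesis sD_flip : forall A : {set 'I_t}, exists nu : aut,
  forall j, nu (sD j) = (-1) ^+ (j \in A) * sD j.
Hypothesis sD_cyc : forall j, in_realcyc z (sD j).
Hypotheses (p3 : forall j, (p j %% 4 = 3)%N) (q3 : forall j, (q j %% 4 = 3)%N).
Hypotheses (p_inj : injective p) (q_inj : injective q) (neq_pq : forall i j, p i != q j).

(* Every embedding is such a restriction, but this is not needed: the others are
   ignored by the norm and by the descent matrix. *)
Definition is_restriction (i : 'I_d) : bool :=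
  `[< exists nu : aut, forall x, in_realcyc z x -> e i x = nu x >].

Definition fibre (A : {set 'I_t}) : {set 'I_d} :=
  [set i | is_restriction i && (flip sD (e i) == A)].

Lemma flip_restriction i (nu : aut) :
  (forall x, in_realcyc z x -> e i x = nu x) -> flip sD (e i) = flip sD nu.
Proof. by move=> enu; apply/setP => j; rewrite !inE enu. Qed.

Lemma embedding_inj i j : (forall x, in_realcyc z x -> e i x = e j x) -> i = j.
Proof.
case: enum_e => _ dist _ eij; have [//|/dist[x [xz]]] := eqVneq i j.
by rewrite eij // eqxx.
Qed.

Lemma restriction_exists (nu : aut) :
  exists2 i, is_restriction i & forall x, in_realcyc z x -> e i x = nu x.
Proof.
case: enum_e => _ _ /(_ nu (real_embedding_aut n_gt0 prim_z nu))[i ei].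
have enu x : in_realcyc z x -> e i x = nu x by move=> xz; rewrite ei.
by exists i => //; apply/asboolP; exists nu.
Qed.

(** For [A = set0] this is the norm to F; the other fibres give its conjugates. *)
Definition fibre_norm (A : {set 'I_t}) (u : algC) := \prod_(i in fibre A) e i u.

(** Composition with [nu] is an injection [h] on restrictions. It exchanges the fibres over [set0]
    and [flip sD nu], so these have the same size and [h] is a bijection between them. *)
Lemma fibre_norm_aut (nu : aut) u : in_realcyc z u ->
  nu (fibre_norm set0 u) = fibre_norm (flip sD nu) u.
Proof.
move=> uz; have flipE := flip_comp pr_p pr_q sD_sq.
have shift i : exists j, is_restriction i ->
    is_restriction j /\ forall x, in_realcyc z x -> e j x = nu (e i x).
  have [/asboolP[mu emu]|_] := boolP (is_restriction i); last by exists i.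
  have [j rj ej] := restriction_exists (nu \o mu).
  by exists j => _; split=> // x xz; rewrite ej // emu.
have [h hP] := boolp.choice shift.
have h_inj : {in is_restriction &, injective h}.
  move=> i j ri rj hij; apply: embedding_inj => x xz; apply: (fmorph_inj nu).
  have [_ <- //] := hP i ri; have [_ <- //] := hP j rj.
  by rewrite hij.
have h_flip i : is_restriction i -> flip sD (e (h i)) = symdiff (flip sD nu) (flip sD (e i)).
  move=> ri; have /asboolP[mu emu] := ri; have [_ eh] := hP i ri.
  rewrite (flip_restriction emu) -flipE; apply: flip_restriction => x xz.
  by rewrite eh //= emu.
have h_fibre A : h @: fibre A \subset fibre (symdiff (flip sD nu) A).
  apply/subsetP => _ /imsetP[i iA ->]; move: iA; rewrite !inE => /andP[ri /eqP <-].
  by have [-> _] := hP i ri; rewrite h_flip ?eqxx.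
have card_h A : #|h @: fibre A| = #|fibre A|.
  by apply: card_in_imset => i j; rewrite !inE => /andP[ri _] /andP[rj _]; apply: h_inj.
have him : h @: fibre set0 = fibre (flip sD nu).
  have e0 : symdiff (flip sD nu) set0 = flip sD nu by exact: symdiff0.
  apply/eqP; rewrite eqEcard -{1}e0 h_fibre card_h /=.
  by have := h_fibre (flip sD nu); rewrite symdiffAA => /subset_leq_card; rewrite card_h.
rewrite rmorph_prod /fibre_norm -him big_imset /= => [|i j]; last first.
  by rewrite !inE => /andP[ri _] /andP[rj _]; apply: h_inj.
by apply: eq_bigr => i; rewrite inE => /andP[ri _]; have [_ ->] := hP i ri.
Qed.

Lemma fibre_unit A i u : is_unit_realcyc z u -> i \in fibre A ->
  [/\ e i u \is Num.real, e i u != 0, e i u \in Aint & (e i u)^-1 \in Aint].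
Proof.
move=> [uz u0 uA uA']; rewrite inE => /andP[/asboolP[nu enu] _].
rewrite enu //; split; rewrite ?fmorph_eq0 ?Aint_aut // -?fmorphV ?Aint_aut //.
by have [] := in_realcyc_aut n_gt0 prim_z nu uz.
Qed.

(** The witness is the norm to F multiplied by its own sign. *)
Lemma fibre_norm_posunit u : is_unit_realcyc z u ->
  exists2 w, posunit sD w & forall nu : aut,
    (nu w < 0) = (fibre_norm (flip sD nu) u < 0) (+) (fibre_norm set0 u < 0).
Proof.
move=> uu; have uz : in_realcyc z u by case: uu.
set v := fibre_norm set0 u.
have fix_v : fixed sD v.
  by move=> nu nu0; rewrite fibre_norm_aut // nu0.
have v0 : v != 0 by apply/prodf_neq0 => i /(fibre_unit uu)[].
have vR (nu : aut) : nu v \is Num.real by exact: (fixed_real pr_p pr_q sD_sq).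
have vR1 : v \is Num.real := vR idfun.
exists ((-1) ^+ (v < 0)%R * v) => [|nu]; last first.
  rewrite -fibre_norm_aut // -/v rmorphM rmorphXn rmorphN1.
  case: (real_ltgt0P vR1) v0 => // [v_gt0|v_lt0] _.
  - by rewrite mul1r addbF.
  - rewrite mulN1r oppr_lt0 addbT; have : nu v != 0 by rewrite fmorph_eq0 lt_eqF.
    by case: (real_ltgt0P (vR nu)).
have vA : v \in Aint by apply: rpred_prod => i /(fibre_unit uu)[].
have vA' : v^-1 \in Aint by rewrite -prodfV; apply: rpred_prod => i /(fibre_unit uu)[].
split.
- by case: (real_ltgt0P vR1) v0 => // v1 _; rewrite ?mul1r ?mulN1r ?oppr_gt0.
- by rewrite rpredMsign.
- by rewrite invfM -exprVn invrN1 rpredMsign.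
by move=> nu nu0; rewrite rmorphM rmorphXn rmorphN1 fix_v.
Qed.

Let X := [set A : {set 'I_t} | A != set0].

(* Sends the signature of u to that of the norm of u, made positive by a change
   of sign, which accounts for the fibre over [set0]. *)
Definition descent_mx : 'M['F_2]_(d, #|X|) :=
  \matrix_(i, k) ((i \in fibre (enum_val k)) || (i \in fibre set0))%:R.

Lemma fibre_disjoint (k : 'I_#|X|) i :
  (i \in fibre (enum_val k)) && (i \in fibre set0) = false.
Proof.
apply/negP => /andP[]; rewrite !inE => /andP[_ /eqP ->] /andP[_ ek].
by have := enum_valP k; rewrite inE ek.
Qed.

(** Choosing one embedding [f k] in each fibre gives a left inverse, since the fibres are
    disjoint. *)
Lemma descent_mx_full : row_full descent_mx.
Proof.
have ex k : exists i, i \in fibre (enum_val (A := X) k).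
  have [i ri ei] := restriction_exists (rep sD_flip (enum_val k)).
  exists i; rewrite inE ri (flip_restriction ei).
  by rewrite (flip_rep pr_p pr_q sD_sq) eqxx.
have [f fP] := boolp.choice ex.
apply/row_fullP; exists (\matrix_(k, i) (i == f k)%:R); apply/matrixP => k l.
rewrite !mxE (bigD1 (f k)) //= !mxE eqxx mul1r big1 ?addr0 => [|i /negbTE ik]; last first.
  by rewrite !mxE ik mul0r.
have := fibre_disjoint k (f k); rewrite fP /= => ->; rewrite orbF.
have := fP k; rewrite !inE => /andP[-> /eqP ->] /=.
by rewrite (inj_eq enum_val_inj).
Qed.

Lemma signature_descent u k : is_unit_realcyc z u ->
  (signature e u *m descent_mx) 0 k =
  ((fibre_norm (enum_val k) u < 0) (+) (fibre_norm set0 u < 0))%R%:R.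
Proof.
move=> uu; rewrite addb_F2 !prod_lt0_F2; try by move=> i /(fibre_unit uu)[].
rewrite mxE [X in _ = X + _]big_mkcond [X in _ = _ + X]big_mkcond -big_split /=.
apply: eq_bigr => i _.
rewrite !mxE; have := fibre_disjoint k i.
by case: (i \in fibre _); case: (i \in fibre _); rewrite //= ?mulr1 ?mulr0 ?addr0 ?add0r.
Qed.

(** Products of units add signatures and scalars in ['F_2] are 0 or 1, so the property passes from
    signatures to their span. *)
Lemma sub_signature_space (v : 'rV_d) : (v <= unit_signature_space z e)%MS ->
  exists2 w, posunit sD w & forall k (nu : aut), flip sD nu = enum_val k ->
    (v *m descent_mx) 0 k = (nu w < 0)%R%:R.
Proof.
pose Q (v : 'rV_d) := exists2 w, posunit sD w & forall k (nu : aut),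
  flip sD nu = enum_val k -> (v *m descent_mx) 0 k = (nu w < 0)%R%:R.
have Q0 : Q 0.
  exists 1 => [|k nu _]; first exact: posunit1.
  by rewrite mul0mx mxE rmorph1 ltr10.
case/sub_sumsmxP => u_ ->.
apply: (big_ind Q) => // [v1 v2 [w1 u1 D1] [w2 u2 D2]|v' /asboolP[u [uu Du]]].
  exists (w1 * w2) => [|k nu nuk]; first exact: posunitM.
  have realw w : posunit sD w -> nu w \is Num.real /\ nu w != 0.
    case=> w_gt0 _ _ fw; rewrite fmorph_eq0 gt_eqF //.
    by split=> //; apply: (fixed_real pr_p pr_q sD_sq).
  have [r1 n1] := realw _ u1; have [r2 n2] := realw _ u2.
  by rewrite mulmxDl mxE (D1 k nu) // (D2 k nu) // rmorphM mul_lt0_addb // addb_F2.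
have /sub_rVP[a ->] : (u_ v' *m <<v'>> <= v')%MS.
  by rewrite (submx_trans (submxMl _ _)) ?genmxE.
have [->|->] := F2_bool a; first by rewrite scale0r.
rewrite scale1r -Du; have [w uw Dw] := fibre_norm_posunit uu; exists w => // k nu nuk.
by rewrite signature_descent // Dw nuk.
Qed.

(** The rank of [V] is that of its image, at most [2 ^ t - 1 - t], plus that of its part in the
    kernel, at most [d - (2 ^ t - 1)]; the sum is at most [d - t]. *)
Lemma deficiency_ge : (t <= deficiency z e)%N.
Proof.
set V := unit_signature_space z e; pose s := \rank (V *m descent_mx).
have cardX : #|X| = (2 ^ t - 1)%N.
  have -> : X = ~: [set set0] by apply/setP => A; rewrite !inE.
  by rewrite cardsCs setCK cards1 -cardsT -powersetT card_powerset cardsT card_ord.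
have row_unit i : exists w, posunit sD w /\ forall k (nu : aut), flip sD nu = enum_val k ->
    row_base (V *m descent_mx) i k = (nu w < 0)%R%:R.
  have : (row i (row_base (V *m descent_mx)) <= V *m descent_mx)%MS.
    by rewrite (submx_trans (row_sub _ _)) ?eq_row_base.
  case/submxP => D DD; have [w uw Dw] := sub_signature_space (submxMl D V).
  exists w; split=> // k nu nuk; rewrite -(Dw k nu nuk) -mulmxA -DD.
  by rewrite [RHS]mxE.
have [w wP] := boolp.choice row_unit.
have le_s : (s <= 2 ^ t - 1 - t)%N.
  apply: (signature_bound pr_p pr_q sD_sq sD_flip p3 q3 p_inj q_inj neq_pq (w := w)).
    by move=> i; case: (wP i).
  move=> I posI; pose c : 'rV['F_2]_s := \row_i (i \in I)%:R.
  (* A totally positive subproduct makes the corresponding sum of basis rows vanish, so [c = 0] by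
     independence. *)
  have : c *m row_base (V *m descent_mx) = 0.
    apply/rowP => k; rewrite [LHS]mxE [RHS]mxE; pose nu := rep sD_flip (enum_val k).
    have nuk : flip sD nu = enum_val k by exact: (flip_rep pr_p pr_q sD_sq).
    transitivity (\sum_(i in I) (nu (w i) < 0)%R%:R : 'F_2).
      rewrite [RHS]big_mkcond; apply: eq_bigr => i _; rewrite [c 0 i]mxE.
      by case: (wP i) => _ /(_ k nu nuk) ->; case: (i \in I); rewrite ?mul1r ?mul0r.
    rewrite -prod_lt0_F2 => [|i _]; last first.
      case: (wP i) => -[w_gt0 _ _ fw] _; rewrite fmorph_eq0 gt_eqF //; split=> //.
      exact: (fixed_real pr_p pr_q sD_sq).
    by rewrite -rmorph_prod lt_gtF.
  move/eqP; rewrite mulmx_free_eq0 ?row_base_free // => /eqP/rowP c0.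
  apply/setP => i; have := c0 i; rewrite !mxE inE.
  by case: (i \in I).
have rkN : \rank descent_mx = #|X| := eqP descent_mx_full.
have rk := mxrank_mul_ker V descent_mx.
have le_ker : (\rank (V :&: kermx descent_mx) <= d - #|X|)%N.
  by rewrite (leq_trans (mxrankS (capmxSr _ _))) // mxrank_ker rkN.
have le_d : (#|X| <= d)%N by rewrite -rkN rank_leq_row.
have lt_t : (t < 2 ^ t)%N by exact: ltn_expl.
have -> : deficiency z e = (d - \rank V)%N by [].
rewrite -rk -/s.
move: cardX le_s le_ker le_d lt_t; rewrite -/s.
by move: s (\rank (V :&: _)) (2 ^ t)%N => r b a; move: #|X| => x; clear; lia.
Qed.

End Descent.

Lemma in_cyc_sqrt_prod n z l : (0 < n)%N -> n.-primitive_root z ->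
  in_cyc z (sqrt_prod l (z ^+ (n %/ l))).
Proof.
move=> n_gt0 prim_z; apply: in_cyc_prod => k _; apply: in_cycB.
  by do 2!apply: in_cycX; apply: in_cycz.
have z0 : z != 0 by rewrite (prim_root_eq0 prim_z) -lt0n.
(* Writing [z^-1] as [z ^+ n.-1] turns negative powers into polynomials in [z]. *)
have -> : (z ^+ (n %/ l)) ^- k = z ^+ n.-1 ^+ (n %/ l) ^+ k.
  rewrite -!exprVn; congr (_ ^+ _ ^+ _); apply: (mulfI z0).
  by rewrite divff // -exprS prednK // (prim_expr_order prim_z).
by do 3!apply: in_cycX; apply: in_cycz.
Qed.

Theorem theorem6p12 (t n : nat) (z : algC) (d : nat) (e : 'I_d -> algC -> algC) :
  (1 <= t)%N -> (0 < n)%N ->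
  (2 * t <= size [seq p <- primes n | p %% 4 == 3])%N ->
  n.-primitive_root z ->
  embedding_enum z e ->
  (t <= deficiency z e)%N.
Proof.
move=> _ n_gt0; set P := [seq _ <- _ | _] => le_P prim_z enum_e.
have PP m : (m < 2 * t)%N ->
    [/\ prime (nth 0%N P m), (nth 0%N P m %| n)%N & (nth 0%N P m %% 4 = 3)%N].
  move=> lt_m; have := mem_nth 0%N (leq_trans lt_m le_P).
  by rewrite mem_filter mem_primes => /andP[/eqP-> /and3P[]].
have P_inj m m' : (m < 2 * t)%N -> (m' < 2 * t)%N ->
    (nth 0%N P m == nth 0%N P m') = (m == m').
  move=> lt_m lt_m'; apply: nth_uniq; rewrite ?(leq_trans _ le_P) //.
  by rewrite filter_uniq ?primes_uniq.
pose p (j : 'I_t) := nth 0%N P (2 * j); pose q (j : 'I_t) := nth 0%N P (2 * j).+1.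
have lt_p (j : 'I_t) : (2 * j < 2 * t)%N by rewrite ltn_pmul2l.
have lt_q (j : 'I_t) : ((2 * j).+1 < 2 * t)%N by have := ltn_ord j; lia.
pose r l := sqrt_prod l (z ^+ (n %/ l)).
have r_sqr l : prime l -> (l %| n)%N -> (l %% 4 = 3)%N -> r l ^+ 2 = - l%:R.
  by move=> pr_l dv l3; apply: sqrt_prod_sqr => //; apply: dvdn_prim_root.
(* The square roots of [- p j] and [- q j] are imaginary, but their product is real. *)
pose sD j := r (p j) * r (q j).
have sD_sq j : sD j ^+ 2 = (p j * q j)%:R.
  have [pr_p dvp p3] := PP _ (lt_p j); have [pr_q dvq q3] := PP _ (lt_q j).
  by rewrite exprMn !r_sqr // mulrNN natrM.
have p_inj : injective p.
  by move=> i j /eqP; rewrite P_inj // eqn_mul2l => /eqP/val_inj.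
have q_inj : injective q.
  by move=> i j /eqP; rewrite P_inj // eqSS eqn_mul2l => /eqP/val_inj.
have neq_pq i j : p i != q j by rewrite P_inj //; lia.
apply: (@deficiency_ge t n z sD d e n_gt0 prim_z enum_e p q) => //.
- by move=> j; have [] := PP _ (lt_p j).
- by move=> j; have [] := PP _ (lt_q j).
(* Only the [p j] with [j] in [A] are selected: [r (p j)] then changes sign, while every [r (q j)]
   is fixed. *)
- move=> A; pose pi : nat_pred := [pred l | [exists j in A, p j == l]].
  have [nu Dnu] := aut_flip_primes n_gt0 prim_z pi; exists nu => j.
  have [pr_p dvp p3] := PP _ (lt_p j); have [pr_q dvq q3] := PP _ (lt_q j).
  have p_pi : (p j \in pi) = (j \in A).
    apply/exists_inP/idP => [[i iA /eqP/p_inj <-] //|jA]; by exists j.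
  have q_pi : (q j \in pi) = false.
    by apply/exists_inP => -[i _]; rewrite (negbTE (neq_pq i j)).
  have Dq := Dnu _ pr_q dvq; have Dp := Dnu _ pr_p dvp.
  rewrite /= q_pi in Dq; rewrite /= p_pi in Dp.
  rewrite rmorphM /= (sqrt_prod_fix _ Dq); case: (j \in A) Dp => Dp.
    by rewrite (sqrt_prod_flip p3 Dp) mulNr mulN1r.
  by rewrite (sqrt_prod_fix _ Dp) mul1r.
- move=> j; split; first by apply: in_cycM; apply: in_cyc_sqrt_prod.
  by rewrite realEsqr sD_sq ler0n.
- by move=> j; have [] := PP _ (lt_p j).
- by move=> j; have [] := PP _ (lt_q j).
Qed.
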